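(* For any $\epsilon>0$ and $v_0\in\mathbb{R}$, there exists $E\subseteq\mathbb{Z}^2$ such that for all $u\in(-\epsilon,\epsilon)$, \[D(E\cap t_{u,v_0})=D(E)=1.\]
   Context: For a $1$-separated set $E\subset\mathbb{R}^2$ (in particular for any $E\subseteq\mathbb{Z}^2$), the counting dimension $D(E)$ is \[D(E)=\limsup_{\|C\|\to\infty}\frac{\log|E\cap C|}{\log\|C\|},\] where $C\subset\mathbb{R}^2$ ranges over arbitrary squares (placed anywhere in the plane) with sides parallel to the coordinate axes, $\|C\|$ is the side length of $C$, and the limsup means $\lim_{R\to\infty}\sup_{\|C\|\ge R}$. For $u,v\in\mathbb{R}$ with $u\neq0$, the width-1 tube $t_{u,v}$ is \[t_{u,v}=\Big\{(x,y)\in\mathbb{R}^2 : -\tfrac1u x+v\sqrt{1+\tfrac1{u^2}}<y\le-\tfrac1u x+(v+1)\sqrt{1+\tfrac1{u^2}}\Big\}.\] The line through the origin perpendicular to it has slope $u$. For $u=0$, $t_{0,v}=\{(x,y)\in\mathbb{R}^2: v<x\le v+1\}$ (vertical tube). *)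

(* Defs.v *)
From HB Require Import structures.
From mathcomp Require Import all_boot all_order all_algebra.
From mathcomp Require Import all_classical all_reals all_analysis.
Import Order.TTheory GRing.Theory Num.Theory.
Import numFieldNormedType.Exports.

Set Implicit Arguments.
Unset Strict Implicit.
Unset Printing Implicit Defensive.

Local Open Scope classical_set_scope.
Local Open Scope ring_scope.

Definition int_lattice {R : realType} : set (R * R) :=
  [set p | p.1 \is a Num.int /\ p.2 \is a Num.int].

Definition square {R : realType} (a b s : R) : set (R * R) :=
  `[a, a + s] `*` `[b, b + s].

(* [lne 0 = -oo], so a square that misses [E] never contributes to the
   supremum below as soon as its side exceeds 1. *)
Definition log_ratio {R : realType} (E : set (R * R)) (a b s : R) : \bar R :=
  (lne (counting (E `&` square a b s)) / (ln s)%:E)%E.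

Definition sup_log_ratio {R : realType} (E : set (R * R)) (r : R) : \bar R :=
  ereal_sup [set x | exists a b s : R, r <= s /\ x = log_ratio E a b s].

(* Meant for 1-separated [E], for which all the counts are finite.  The value
   is in [\bar R]: it is [-oo] for the empty set. *)
Definition counting_dim {R : realType} (E : set (R * R)) : \bar R :=
  lim (sup_log_ratio E r @[r --> +oo]).

(* The limit defining [counting_dim] always exists. *)
Lemma is_cvg_sup_log_ratio {R : realType} (E : set (R * R)) :
  cvg (sup_log_ratio E r @[r --> +oo]).
Proof.
apply: cvgP; apply: nonincreasing_cvge => r r' rr'.
apply: ereal_sup_le => x /= [a [b [s [r's ->]]]].
by exists a, b, s; split=> //; exact: le_trans r's.
Qed.

Definition tube {R : realType} (u v : R) : set (R * R) :=
  if u == 0 then [set p | v < p.1 <= v + 1]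
  else [set p | - (1 / u) * p.1 + v * Num.sqrt (1 + 1 / u ^+ 2) < p.2
             <= - (1 / u) * p.1 + (v + 1) * Num.sqrt (1 + 1 / u ^+ 2)].

(* Main.v *)
(** Let [w y = eps * sin (ln (ln y))] and let [E] consist of the lattice points
    within a constant horizontal distance of the curve [x = - w y * y].  Each
    row holds boundedly many points of [E], so a square of side [s] contains
    O(s) of them and the dimension is at most 1.  The slope [w] takes every
    value [u] in ]-eps, eps[ infinitely often, and so slowly ([w'] is of order
    1 / (y ln y)) that, on windows of any prescribed length [L] high enough,
    [`|w y - u| * y <= 1]: there [E] follows the tube of parameter [u].  As
    every tube meets every row in a lattice point, [E] has at least [c * s]
    points of that tube in a suitable square of side [s]. *)
Require Import Defs.
From mathcomp Require Import all_boot all_order all_algebra.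
From mathcomp Require Import all_classical all_reals all_analysis.
From mathcomp Require Import ring lra.
Import Order.TTheory GRing.Theory Num.Theory.
Import numFieldNormedType.Exports.
Local Open Scope classical_set_scope.
Local Open Scope ring_scope.

(** * Cardinality bounds by finite sequences *)

Lemma counting_ge0 {T : choiceType} {R : realType} (A : set T) :
  (0 <= counting A :> \bar R)%E.
Proof. by rewrite /counting; case: ifP; rewrite ?leey// lee_fin. Qed.

Lemma counting_le_size {T : choiceType} {R : realType} (A : set T)
    (s : seq T) :
  A `<=` [set` s] -> (counting A <= (size s)%:R%:E :> \bar R)%E.
Proof.
move=> As; have finA : finite_set A by exact: sub_finite_set (finite_seq s).
rewrite /counting asboolT// lee_fin ler_nat.
apply: uniq_leq_size => [|x]; first exact: finmap.fset_uniq.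
by rewrite in_fset_set// inE => /As.
Qed.

Lemma size_le_counting {T : choiceType} {R : realType} (A : set T)
    (s : seq T) :
  uniq s -> [set` s] `<=` A -> ((size s)%:R%:E <= counting A :> \bar R)%E.
Proof.
move=> us sA; rewrite /counting; case: ifP => [/asboolP finA|_]; last first.
  exact: leey.
rewrite lee_fin ler_nat; apply: uniq_leq_size => // x xs.
by rewrite in_fset_set// inE; exact: sA.
Qed.

(** * From linear counts to dimension one *)

Lemma log_ratio_le {R : realType} (E : set (R * R)) (a b s C d : R) :
  0 < C -> 1 < s -> ln C <= d * ln s ->
  (counting (E `&` square a b s) <= (C * s)%:E)%E ->
  (log_ratio E a b s <= (1 + d)%:E)%E.
Proof.
move=> C0 s1 Cd cE; have s0 : 0 < s by exact: lt_trans s1.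
have ls0 : 0 < ln s by rewrite ln_gt0.
rewrite /log_ratio inver gt_eqF// lee_pdivrMr// -EFinM.
apply: (@le_trans _ _ (lne (C * s)%:E)).
  rewrite lee_lne// in_itv/= leey andbT ?lee_fin; last exact/ltW/mulr_gt0.
  exact: counting_ge0.
by rewrite lne_EFin ?mulr_gt0// lee_fin lnM ?posrE// mulrDl mul1r addrC lerD2l.
Qed.

Lemma log_ratio_ge {R : realType} (E : set (R * R)) (a b s c d : R) :
  0 < c -> 1 < s -> - ln c <= d * ln s ->
  ((c * s)%:E <= counting (E `&` square a b s))%E ->
  ((1 - d)%:E <= log_ratio E a b s)%E.
Proof.
move=> c0 s1 cd cE; have s0 : 0 < s by exact: lt_trans s1.
have ls0 : 0 < ln s by rewrite ln_gt0.
rewrite /log_ratio inver gt_eqF// lee_pdivlMr// -EFinM.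
apply: (@le_trans _ _ (lne (c * s)%:E)).
  rewrite lne_EFin ?mulr_gt0// lee_fin lnM ?posrE//; lra.
rewrite lee_lne// in_itv/= leey andbT ?lee_fin; first exact/ltW/mulr_gt0.
exact: counting_ge0.
Qed.

Lemma ln_large {R : realType} (x d : R) : 0 < d ->
  exists2 r : R, 1 < r & forall s, r <= s -> x <= d * ln s.
Proof.
move=> d0; exists (expR (1 + `|x| / d)).
  by rewrite expR_gt1 ltr_pwDl// divr_ge0// ltW.
move=> s rs.
have lns : 1 + `|x| / d <= ln s.
  rewrite -[leLHS]expRK ler_ln ?posrE ?expR_gt0//.
  exact: lt_le_trans (expR_gt0 _) rs.
rewrite mulrC -ler_pdivrMr//; apply: le_trans lns.
by rewrite ler_wpDl// ler_pM2r ?invr_gt0// ler_norm.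
Qed.

(** Multiplicative constants disappear after division by [ln s]. The upper bound must hold for every
    square, while one rich square of each large side is enough for the lower bound, because of the
    supremum. As [sup_log_ratio E] is nonincreasing, its limit is its infimum. *)
Lemma counting_dim_eq1 {R : realType} (E : set (R * R)) (c C s0 : R) :
  0 < c -> 0 < C ->
  (forall a b s, 1 <= s -> (counting (E `&` square a b s) <= (C * s)%:E)%E) ->
  (forall s, s0 <= s -> exists a b,
     ((c * s)%:E <= counting (E `&` square a b s))%E) ->
  counting_dim E = 1%:E.
Proof.
move=> c0 C0 upE loE; apply: cvg_lim => //.
have -> : 1%:E = ereal_inf (range (sup_log_ratio E)).
  apply/eqP; rewrite eq_le; apply/andP; split.
    apply: le_ereal_inf_tmp => _ [r _ <-].
    apply/lee_subgt0Pr => d d0; rewrite -EFinB.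
    have [r' r'1 lnc] := ln_large (- ln c) d d0.
    (* The side must be admissible in the supremum ([r]), make [- ln c] negligible ([r']) and admit
       a rich square ([s0]). *)
    pose s := Num.max r (Num.max r' s0).
    have [a [b cE]] := loE s ltac:(by rewrite !le_max lexx !orbT).
    have rs : r' <= s by rewrite !le_max lexx !orbT.
    apply: (@le_trans _ _ (log_ratio E a b s)).
      apply: (@log_ratio_ge _ _ _ _ _ c) => //; last exact: lnc.
      exact: lt_le_trans rs.
    apply: ereal_sup_ubound; exists a, b, s; split=> //.
    by rewrite le_max lexx.
  apply/lee_addgt0Pr => d d0; rewrite -EFinD.
  have [r r1 lnC] := ln_large (ln C) d d0.
  apply: (@le_trans _ _ (sup_log_ratio E r)); first exact: ereal_inf_lbound.
  apply: ge_ereal_sup => _ [a [b [s [rs ->]]]].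
  have s1 := lt_le_trans r1 rs.
  by apply: (@log_ratio_le _ _ _ _ _ C) => //; [exact: lnC | exact/upE/ltW].
apply: nonincreasing_cvge => r r' rr'.
apply: ereal_sup_le => x /= [a [b [s [r's ->]]]].
by exists a, b, s; split=> //; exact: le_trans r's.
Qed.

(** * Lattice points in squares and in tubes *)

(** Rounding [x] down and rounding [l] down each cost less than 1, whence the 2. *)
Lemma int_in_segment {R : realType} (x l : R) (m : int) :
  0 <= l -> x <= m%:~R <= x + l ->
  exists2 i, (i < Num.truncn l + 2)%N & m = Num.floor x + i%:Z.
Proof.
move=> l0 /andP[xm mx]; have fm : Num.floor x <= m.
  by rewrite -(ler_int R); apply: le_trans xm; exact: floor_le_tmp.
exists `|m - Num.floor x|%N; last first.
  by rewrite gez0_abs ?subr_ge0// addrCA subrr addr0.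
rewrite -(ltr_nat R) natr_absz ger0_norm ?subr_ge0// rmorphB/= natrD.
have := floorD1_gt x; have := truncnS_gt l; rewrite -natr1 intrD.
lra.
Qed.

Lemma counting_square_le {R : realType} (E : set (R * R)) (g : R -> R)
    (K a b s : R) :
  0 <= K -> E `<=` int_lattice ->
  (forall p, E p -> `|p.1 - g p.2| <= K) -> 1 <= s ->
  (counting (E `&` square a b s)
     <= ((Num.truncn (2 * K) + 2)%:R * 3 * s)%:E)%E.
Proof.
move=> K0 EZ Eg s1; have s0 : 0 <= s by exact: le_trans s1.
pose row i : R := (Num.floor b + i%:Z)%:~R.
pose pt i j : R * R := ((Num.floor (g (row i) - K) + j%:Z)%:~R, row i).
pose pts := [seq pt i j | i <- iota 0 (Num.truncn s + 2),
                          j <- iota 0 (Num.truncn (2 * K) + 2)].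
have Epts : E `&` square a b s `<=` [set` pts].
  move=> [x y] [Exy]; rewrite /square/= => -[_].
  have [/= /intrP[mx ex] /intrP[my ey]] := EZ _ Exy.
  have := Eg _ Exy; rewrite /= ex ey ler_distl in_itv/= => gm byb.
  have [i il ei] := int_in_segment _ _ _ s0 byb.
  have [||j jl ej] := int_in_segment (g my%:~R - K) (2 * K) mx.
  - lra.
  - lra.
  apply/allpairsP; exists (i, j); rewrite !mem_iota/= !add0n; split=> //.
  by rewrite /pt /row -ei -ej.
apply: le_trans (counting_le_size _ _ Epts) _; rewrite lee_fin.
(* As [1 <= s], the number of rows, [Num.truncn s + 2], is at most [3 * s]. *)
rewrite size_allpairs !size_iota natrM mulrC -mulrA ler_wpM2l// natrD.
have : (Num.truncn s)%:R <= s by rewrite truncn_le.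
lra.
Qed.

(* In the form [v * q < x + u * y <= (v + 1) * q] with [q = sqrt (1 + u^2)],
   the tube has horizontal width [q >= 1]; for [u < 0] multiplying by [u]
   reverses the inequalities, which puts the tube on the side of [- v]. *)
Lemma tube_row {R : realType} (u v y : R) :
  exists2 m : int, tube u v (m%:~R, y) &
    `|m%:~R + u * y| <= (`|v| + 1) * (1 + `|u|).
Proof.
have bound z q : v * q <= z <= (v + 1) * q -> 0 <= q -> q <= 1 + `|u| ->
    `|z| <= (`|v| + 1) * (1 + `|u|).
  move=> /andP[zl zu] q0 qu.
  apply: (@le_trans _ _ ((`|v| + 1) * q)); last by rewrite ler_wpM2l// addr_ge0.
  have := ler_wpM2r q0 (ler_norm v); have := ler_wpM2r q0 (ler_norm (- v)).
  by rewrite normrN ler_norml; nra.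
rewrite /tube; have [u00|u0] := eqVneq u 0.
  exists (Num.floor v + 1).
    by rewrite /= floorD1_gt/= intrD lerD2r floor_le_tmp.
  rewrite {1}u00; apply: (bound _ 1); rewrite ?mul0r ?addr0 ?mulr1//.
    2: by rewrite lerDl.
  by rewrite (ltW (floorD1_gt _))/= intrD lerD2r floor_le_tmp.
set r := Num.sqrt _; pose q := `|u| * r.
have u2 : 0 < u ^+ 2 by rewrite exprn_even_gt0.
have q2 : q ^+ 2 = 1 + u ^+ 2.
  rewrite exprMn sqr_sqrtr ?addr_ge0 ?divr_ge0 ?ltW//.
  by rewrite real_normK ?num_real//; field.
have q_ge0 : 0 <= q by rewrite mulr_ge0// sqrtr_ge0.
have q1 : 1 <= q by nra.
have qu : q <= 1 + `|u|.
  have : u ^+ 2 = `|u| ^+ 2 by rewrite real_normK ?num_real.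
  have := normr_ge0 u; nra.
have [up|un|] := ltgtP 0 u; last by move=> u00; rewrite -u00 eqxx in u0.
(* The first integer strictly beyond the open left end; [1 <= q] keeps it in the tube. *)
- pose m := Num.floor (v * q - u * y) + 1.
  have ml : v * q < m%:~R + u * y.
    by have := floorD1_gt (v * q - u * y); rewrite -/m; lra.
  have mu : m%:~R + u * y <= (v + 1) * q.
    by have := floor_le_tmp (v * q - u * y); rewrite /m intrD; lra.
  have rq : r = q / u by rewrite /q gtr0_norm//; field.
  exists m; last by apply: (bound _ q) => //; rewrite (ltW ml).
  rewrite /= rq; apply/andP; split.
    rewrite -subr_gt0.
    have -> : y - (- (1 / u) * m%:~R + v * (q / u)) =
        (m%:~R + u * y - v * q) / u by field.
    by rewrite divr_gt0// subr_gt0.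
  rewrite -subr_ge0.
  have -> : - (1 / u) * m%:~R + (v + 1) * (q / u) - y =
      ((v + 1) * q - (m%:~R + u * y)) / u by field.
  by rewrite divr_ge0 ?subr_ge0// ltW.
(* The left end is now the closed one, so [Num.ceil] replaces the floor plus 1. *)
- pose m := Num.ceil (- (v + 1) * q - u * y).
  have ml : - (v + 1) * q <= m%:~R + u * y.
    by have := ceil_ge (- (v + 1) * q - u * y); rewrite -/m; lra.
  have mu : m%:~R + u * y < - v * q.
    by have := ceilB1_lt (- (v + 1) * q - u * y); rewrite -/m intrD; lra.
  have rq : r = - q / u by rewrite /q ltr0_norm//; field.
  exists m.
    rewrite /= rq; apply/andP; split.
      rewrite -subr_gt0.
      have -> : y - (- (1 / u) * m%:~R + v * (- q / u)) =
          (- v * q - (m%:~R + u * y)) / - u by field.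
      by rewrite divr_gt0 ?subr_gt0 ?oppr_gt0.
    rewrite -subr_ge0.
    have -> : - (1 / u) * m%:~R + (v + 1) * (- q / u) - y =
        (m%:~R + u * y - - (v + 1) * q) / - u by field.
    by rewrite divr_ge0 ?subr_ge0 ?oppr_ge0// ltW.
  rewrite -normrN; apply: (bound _ q) => //; apply/andP; split; lra.
Qed.

(** * The slowly oscillating slope *)

Lemma sin_lipschitz {R : realType} (x y : R) : `|sin x - sin y| <= `|x - y|.
Proof.
wlog yx : x y / y <= x => [H|].
  by have [/H//|/ltW/H] := leP y x; rewrite distrC [leRHS]distrC.
have sinC : {within `[y, x], continuous (@sin R)}.
  by apply: continuous_subspaceT; exact: continuous_sin.
have [c _ ->] := MVT_segment yx (fun z _ => is_derive_sin z) sinC.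
by rewrite normrM ler_piMl// cos_max.
Qed.

Lemma ln_increment {R : realType} (x y : R) : 0 < x -> x <= y ->
  0 <= ln y - ln x <= (y - x) / x.
Proof.
move=> x0 xy; have y0 := lt_le_trans x0 xy.
rewrite subr_ge0 ler_ln ?posrE// xy/= -ln_div ?posrE//.
have -> : y / x = 1 + (y - x) / x by field; rewrite gt_eqF.
by apply: le_ln1Dx; rewrite (@lt_le_trans _ _ 0)// divr_ge0 ?subr_ge0// ltW.
Qed.

(** At [t = expR (expR z)] with [sin z = u / eps] the slope is exactly [u]. Over a length [L + 1]
    beyond [t], [ln (ln y)] grows by at most [(L + 1) / (t * l)], where [l = ln t]. The factor
    [y <= 2 * t] cancels [t], and a large [l] absorbs the rest. *)
Lemma sin_lnln_near {R : realType} (eps u L : R) : 0 < eps ->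
  u \in `]- eps, eps[ -> 0 <= L ->
  exists n : nat, forall y, n%:R <= y <= n%:R + L ->
    `|(eps * sin (ln (ln y)) - u) * y| <= 1.
Proof.
move=> eps0; rewrite in_itv/= => /andP[u1 u2] L0.
(* Exceeds both [L + 1], needed for [y <= 2 * t], and [2 * eps * (L + 1)], the numerator of the
   final bound. *)
pose A := 1 + (2 * eps + 1) * (L + 1).
have A1 : 1 <= A by rewrite lerDl mulr_ge0 ?addr_ge0 ?mulr_ge0// ltW.
pose th := asin (u / eps).
have sth : sin th = u / eps.
  rewrite asinK// in_itv/= ler_pdivlMr// ler_pdivrMr// mulN1r mul1r.
  by rewrite !ltW.
(* Each full turn adds more than 1, so [k.+1] turns lift [th] above [A] and preserve its sine. *)
pose k := Num.truncn (A - th).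
pose z := th + (pi *+ 2) *+ k.+1.
have sz : sin z = u / eps.
  rewrite /z -sth; exact/periodicn/sinD2pi.
have zA : A <= z.
  have := truncnS_gt (A - th); rewrite -/k => kA.
  have : k.+1%:R <= pi *+ 2 *+ k.+1 :> R.
    by rewrite lerMn2r/= mulr2n; have := pi_ge2 R; lra.
  rewrite /z; lra.
pose l := expR z; pose t := expR l.
have lA : A <= l by have := expR_ge1Dx z; rewrite -/l; lra.
have tl : l <= t by have := expR_ge1Dx l; rewrite -/t; lra.
(* This integer lies in []t, t + 1]], so the window is contained in [[t, t + L + 1]]. *)
exists (Num.truncn t).+1 => y /andP[ny yn].
have ty : t <= y by apply: le_trans ny; exact/ltW/truncnS_gt.
have yt : y - t <= L + 1.
  have : (Num.truncn t)%:R <= t by rewrite truncn_le expR_ge0.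
  by rewrite -natr1 in yn; lra.
have t0 : 0 < t by exact: expR_gt0.
have l0 : 0 < l by exact: expR_gt0.
have lnt : ln t = l by rewrite expRK.
have lnl : ln l = z by rewrite expRK.
have /andP[d1 d1'] := ln_increment _ _ t0 ty.
rewrite lnt subr_ge0 in d1.
have /andP[d2 d2'] := ln_increment _ _ l0 d1.
have : `|sin (ln (ln y)) - sin z| <= (L + 1) / (t * l).
  apply: le_trans (sin_lipschitz _ _) _; rewrite -lnl ger0_norm//.
  apply: le_trans d2' _; rewrite invfM mulrA ler_pM2r ?invr_gt0// -lnt.
  by apply: le_trans d1' _; rewrite ler_pM2r ?invr_gt0.
rewrite sz => dsin.
have -> : eps * sin (ln (ln y)) - u = eps * (sin (ln (ln y)) - u / eps).
  by field; rewrite gt_eqF.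
rewrite !normrM (gtr0_norm eps0) (gtr0_norm (lt_le_trans t0 ty)).
have y2t : y <= 2 * t.
  have : L + 1 <= A by rewrite /A; nra.
  lra.
apply: (@le_trans _ _ (eps * ((L + 1) / (t * l)) * (2 * t))).
  by rewrite ler_pM ?mulr_ge0// ?ler_wpM2l// ?ltW// (lt_le_trans t0 ty).
have -> : eps * ((L + 1) / (t * l)) * (2 * t) = (2 * eps * (L + 1)) / l.
  by field; rewrite !gt_eqF.
rewrite ler_pdivrMr// mul1r; apply: le_trans lA; rewrite /A; nra.
Qed.

Theorem theorem4 (R : realType) (eps v0 : R) (heps : 0 < eps) :
  exists E : set (R * R),
    E `<=` int_lattice /\
    (forall u : R, u \in `]- eps, eps[ ->
       counting_dim (E `&` tube u v0) = counting_dim E /\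
       counting_dim E = 1%:E).
Proof.
(* Bounds the constant of [tube_row] uniformly over [u] in the interval. *)
pose K := (`|v0| + 1) * (1 + eps).
have K0 : 0 <= K by rewrite mulr_ge0 ?addr_ge0// ltW.
pose w (y : R) := eps * sin (ln (ln y)).
(* The extra 1 absorbs the deviation between the curve and the tube given by [sin_lnln_near]. *)
pose E := [set p : R * R | int_lattice p /\ `|p.1 + w p.2 * p.2| <= K + 1].
have EZ : E `<=` int_lattice by move=> p [].
exists E; split; first exact: EZ.
pose C : R := (Num.truncn (2 * (K + 1)) + 2)%:R * 3.
have C0 : 0 < C by rewrite mulr_gt0// ltr0n addn2.
have upE F a b s : F `<=` E -> 1 <= s ->
    (counting (F `&` square a b s) <= (C * s)%:E)%E.
  move=> FE; apply: (@counting_square_le _ _ (fun y => - w y * y)).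
  - by rewrite addr_ge0.
  - exact: subset_trans FE EZ.
  - by move=> p /FE[_]; rewrite mulNr opprK.
(* Any set between [E] intersected with the tube and [E] is allowed, so that both required
   dimensions are instances. *)
have dim1 (F : set (R * R)) u : u \in `]- eps, eps[ ->
    E `&` tube u v0 `<=` F -> F `<=` E -> counting_dim F = 1%:E.
  move=> ueps tF FE.
  have /ltW u_eps : `|u| < eps by move: ueps; rewrite in_itv/= -ltr_norml.
  (* Over [c * s] rows the tube drifts horizontally by at most [eps * c * s <= s / 4]. With
     [K <= s / 4], the chosen points stay within [s / 2] of the abscissa [- (u * n%:R)], the centre
     of the square below. *)
  pose c := (4 * (eps + 1))^-1.
  have c0 : 0 < c by rewrite invr_gt0 mulr_gt0// addr_gt0.
  apply: (@counting_dim_eq1 _ _ c C (4 * K)) => // [a b s|s sK].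
    exact: upE.
  have s0 : 0 <= s by apply: le_trans sK; rewrite mulr_ge0.
  have cs : c * s * (4 * (eps + 1)) = s.
    by rewrite mulrAC mulVf ?mul1r// gt_eqF// mulr_gt0// addr_gt0.
  have cs0 : 0 <= c * s by rewrite mulr_ge0// ltW.
  have [n nP] := sin_lnln_near _ _ _ heps ueps cs0.
  exists (- (u * n%:R) - s / 2), n%:R.
  pose y i : R := (n + i)%:R.
  pose pt i : R * R := ((sval (cid2 (tube_row u v0 (y i))))%:~R, y i).
  (* One tube point per row: distinct ordinates make them distinct, and there are more than [c * s]
     of them. *)
  pose pts := [seq pt i | i <- iota 0 (Num.truncn (c * s)).+1].
  apply: (@le_trans _ _ ((size pts)%:R%:E)).
    by rewrite lee_fin size_map size_iota ltW// truncnS_gt.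
  apply: size_le_counting.
    rewrite map_inj_in_uniq ?iota_uniq// => i j _ _ [_ /eqP].
    by rewrite eqr_nat eqn_add2l => /eqP.
  move=> _ /mapP[i + ->]; rewrite mem_iota/= add0n ltnS => il.
  rewrite /pt; case: cid2 => m/= mtube mu.
  have {}mu : `|m%:~R + u * y i| <= K.
    by apply: le_trans mu _; rewrite ler_wpM2l ?addr_ge0// lerD2l.
  have ics : i%:R <= c * s.
    apply: le_trans (_ : (Num.truncn (c * s))%:R <= _).
      by rewrite ler_nat.
    by rewrite truncn_le.
  have yE : y i = n%:R + i%:R by rewrite /y natrD.
  have i0 : 0 <= i%:R :> R by [].
  split.
    apply: tF; split=> //; split.
      by split; rewrite ?intr_int// /y /= natr_int.
    have -> : m%:~R + w (y i) * y i =
        (m%:~R + u * y i) + (w (y i) - u) * y i by ring.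
    apply: le_trans (ler_normD _ _) (lerD mu _); apply: nP.
    by rewrite yE; lra.
  have : `|u * i%:R| <= eps * (c * s) by rewrite normrM ler_pM// ger0_norm.
  move: mu; rewrite yE !ler_norml => mu ui.
  rewrite /square /= !in_itv/=; split; nra.
move=> u ueps.
(* For [E] itself any parameter of the interval gives the lower bound; 0 is chosen. *)
have zeps : 0 \in `]- eps, eps[ by rewrite in_itv/= oppr_lt0 heps.
rewrite (dim1 E 0)// ?(dim1 (E `&` tube u v0) u)//; exact: subIsetl.
Qed.
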